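(* Let $\alpha\in[0,1]$. Let $G_1$ be a $t_1$-regular graph of order $n_1$ and size $m_1$, and let $G_2=K_{a,b}$ be the complete bipartite graph of order $n_2=a+b$. (a) When $t_1=1$, the $A_\alpha$-spectrum of $G_1\underline\vee_Q G_2$ comprises: (i) one simple eigenvalue $\alpha$; (ii) one eigenvalue $\alpha(1+a)$ with multiplicity $b-1$; (iii) one eigenvalue $\alpha(1+b)$ with multiplicity $a-1$; and (iv) four eigenvalues obtained by solving the equation $$\big( \nu^2 -\alpha(3+n_2)\nu + (\alpha^2n_2 +4\alpha -2) \big) \big( \nu^2 -\alpha (2 + n_2)\nu +( \alpha^2 + \alpha^2n_2 +2\alpha ab -ab) \big)-(1-\alpha)^2(\nu-\alpha) \big( (\nu-\alpha)n_2 -\alpha n_2^2 + 2ab \big)=0.$$ (b) When $t_1\ge2$, the $A_\alpha$-spectrum of $G_1\underline\vee_Q G_2$ comprises: (i) one eigenvalue $\alpha(2t_1+n_2+2)-2$ with multiplicity $m_1-n_1$; (ii) one eigenvalue $\alpha(m_1+a)$ with multiplicity $b-1$; (iii) one eigenvalue $\alpha(m_1+b)$ with multiplicity $a-1$; (iv) the eigenvalues obtained by solving, for each $i=2,3,\ldots,n_1$, the equation $$\nu^2 -\big( \alpha(t_1 +n_2 +2)+t_1 -2 +\lambda_i(A_{\alpha}(G_1))\big)\nu +\alpha^2 t_1 n_2 + \big( \alpha(t_1 +1)-1\big)\big( t_1 +\lambda_i(A_{\alpha}(G_1))\big)=0;$$ and (v) four eigenvalues obtained by solving the equation $$\begin{aligned}&\big(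 \nu^2 -(\alpha t_1 + \alpha n_2 +2t_1 -2 +2\alpha)\nu + (\alpha^2t_1 n_2 +2\alpha t_1^2 +2\alpha t_1 -2t_1) \big)\\ &\times\big( \nu^2 -(2\alpha m_1 + \alpha n_2)\nu +( \alpha^2m_1^2 + \alpha^2m_1n_2 +2\alpha ab -ab) \big)\\ &-m_1(1-\alpha)^2(\nu-\alpha t_1)\big((\nu-\alpha m_1)n_2 -\alpha n_2^2 +2ab \big)=0.\end{aligned}$$
   Context: All graphs are undirected and simple. For a graph $G$ with adjacency matrix $A(G)$ and diagonal degree matrix $D(G)$, put $A_\alpha(G)=\alpha D(G)+(1-\alpha)A(G)$. The $A_\alpha$-spectrum of $G$ is the multiset of eigenvalues of $A_\alpha(G)$. Eigenvalues of a symmetric $n\times n$ matrix $M$ are ordered $\lambda_1(M)\ge\cdots\ge\lambda_n(M)$. The order of a graph is its number of vertices and its size is its number of edges. $K_{a,b}$ is the complete bipartite graph with parts of sizes $a$ and $b$. The $Q$-graph $\mathcal Q(G)$ is obtained from $G$ by inserting a new vertex into each edge of $G$ (so each edge is subdivided: the new vertex is adjacent to the two ends of the edge, and the original edge is no longer present), and then making two new vertices adjacent whenever they lie on adjacent edges of $G$ (distinct edges sharing an endpoint). The $Q$-edge join $G_1\underline\vee_Q G_2$ is obtained from the disjoint union of $\mathcal Q(G_1)$ and $G_2$ by joining each newly inserted vertex of $\mathcal Q(G_1)$ to every vertex of $G_2$.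
   Formalization: Part (a) is stated for connected G_1 (that is, G_1 = K_2): for a 1-regular G_1 with m_1 > 1 edges the join has 3m_1 + n_2 vertices while the list in (a) has only n_2 + 3 eigenvalues, so (a) fails as written. *)

(* Defs.v *)
From HB Require Import structures.
From mathcomp Require Import all_boot all_order all_algebra.
From mathcomp Require Import polyrcf.

Set Implicit Arguments.
Unset Strict Implicit.
Unset Printing Implicit Defensive.

Import Order.TTheory GRing.Theory Num.Theory.
Local Open Scope ring_scope.

Record sgraph := SGraph {
  vertex :> finType;
  adj : rel vertex;
  adj_sym : symmetric adj;
  adj_irrefl : irreflexive adj
}.

Section Graphs.
Variable G : sgraph.

Definition degree (x : G) : nat := #|[set y | adj x y]|.

Definition regular (t : nat) : Prop := forall x : G, degree x = t.

Definition connected : Prop := forall x y : G, connect (@adj G) x y.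

Definition edges : {set {set G}} :=
  [set A | [exists x, exists y, adj x y && (A == [set x; y])]].

Definition edge : finType := {A : {set G} | A \in edges}.

Definition adjmx (R : pzRingType) : 'M[R]_#|G| :=
  \matrix_(i, j) (adj (enum_val i : G) (enum_val j : G))%:R.

Definition degmx (R : pzRingType) : 'M[R]_#|G| :=
  diag_mx (\row_i (degree (enum_val i))%:R).

Definition Aalpha (R : pzRingType) (alpha : R) : 'M[R]_#|G| :=
  alpha *: degmx R + (1 - alpha) *: adjmx R.

End Graphs.

Section CompleteBipartite.
Variables a b : nat.

Definition Kab_adj : rel ('I_a + 'I_b)%type := fun x y =>
  match x, y with
  | inl _, inr _ | inr _, inl _ => true
  | _, _ => false
  end.

Lemma Kab_sym : symmetric Kab_adj. Proof. by move=> [x|x] [y|y]. Qed.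

Lemma Kab_irrefl : irreflexive Kab_adj. Proof. by move=> [x|x]. Qed.

Definition Kab : sgraph := SGraph Kab_sym Kab_irrefl.

End CompleteBipartite.

(* The new vertex inserted into the edge A is [inr A]. *)
Section QGraph.
Variable G : sgraph.

Definition Q_adj : rel (G + edge G)%type := fun u v =>
  match u, v with
  | inl _, inl _ => false
  | inl x, inr A | inr A, inl x => x \in val A
  | inr A, inr B => (A != B) && (val A :&: val B != set0)
  end.

Lemma Q_sym : symmetric Q_adj.
Proof. by move=> [x|A] [y|B] //=; rewrite eq_sym setIC. Qed.

Lemma Q_irrefl : irreflexive Q_adj.
Proof. by move=> [x|A] //=; rewrite eqxx. Qed.

Definition Qgraph : sgraph := SGraph Q_sym Q_irrefl.

End QGraph.

Section QEdgeJoin.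
Variables G1 G2 : sgraph.

Definition is_new (u : Qgraph G1) : bool := if u is inr _ then true else false.

Definition Qjoin_adj : rel (Qgraph G1 + G2)%type := fun u v =>
  match u, v with
  | inl x, inl y => adj x y
  | inl x, inr _ | inr _, inl x => is_new x
  | inr x, inr y => adj x y
  end.

Lemma Qjoin_sym : symmetric Qjoin_adj.
Proof. by move=> [x|x] [y|y] //; exact: (@adj_sym _ x y). Qed.

Lemma Qjoin_irrefl : irreflexive Qjoin_adj.
Proof. by move=> [x|x]; exact: (@adj_irrefl _ x). Qed.

Definition Qedge_join : sgraph := SGraph Qjoin_sym Qjoin_irrefl.

End QEdgeJoin.

(* The real roots of p in nonincreasing order, each repeated according to its
   multiplicity; [::] if p = 0. *)
Definition realroots (R : rcfType) (p : {poly R}) : seq R :=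
  flatten [seq nseq (mup x p) x | x <- rev (rootsR p)].

(* A real symmetric matrix has only real eigenvalues, so for such a matrix
   this is the full multiset of its eigenvalues. *)
Definition spectrum (R : rcfType) (n : nat) (M : 'M[R]_n) : seq R :=
  realroots (char_poly M).

(* 1-based, so that lambda M 1 >= lambda M 2 >= ... >= lambda M n. *)
Definition lambda (R : rcfType) (n : nat) (M : 'M[R]_n) (i : nat) : R :=
  nth 0 (spectrum M) i.-1.

(* Main.v *)
(* The characteristic polynomial is evaluated at a generic nu.  Two Schur complements, along
   the part K_(a,b) and then along the old vertices, leave a determinant of size m_1 in
   the incidence matrix B of G_1.  The constant blocks fit this shape because J = B^T J B / 4,
   so Sylvester's identity moves everything to size n_1, where B B^T = t_1 + A(G_1)
   turns it into the characteristic polynomial of A_alpha(G_1) perturbed along the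
   all-ones eigenvector.  The sizes m_1 and n_1 enter only through powers of one linear
   factor, and multisets of roots are compared through factorizations; the quartics have
   four real roots because they divide a characteristic polynomial that splits over R. *)
Require Import Defs.
From mathcomp Require Import all_boot all_order all_algebra.
From mathcomp Require Import perm polyrcf complex ring lra zify.

Set Implicit Arguments.
Unset Strict Implicit.
Unset Printing Implicit Defensive.

Import Order.TTheory GRing.Theory Num.Theory.
Local Open Scope ring_scope.

(** * Multisets of real roots of polynomials *)

Section RealRoots.
Variable R : rcfType.
Implicit Types (p q : {poly R}) (x : R) (s : seq R).

Lemma count_flatten_nseq (f : R -> nat) s x : uniq s ->
  count_mem x (flatten [seq nseq (f y) y | y <- s]) = if x \in s then f x else 0%N.
Proof.
elim: s => //= y s IHs /andP[ys us]; rewrite count_cat count_nseq IHs // in_cons /=.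
by have [<-|_] := eqVneq; rewrite /= ?(negPf ys) ?mul1n ?addn0.
Qed.

Lemma count_realroots p x : p != 0 -> count_mem x (realroots p) = mup x p.
Proof.
move=> p0; rewrite count_flatten_nseq.
  rewrite mem_rev -(roots_on_rootsR p0) in_itv /=.
  by case: ifPn => // /mupNroot.
by rewrite rev_uniq; exact: (sorted_uniq lt_trans ltxx (sorted_roots _ _ _)).
Qed.

(** Each value is counted on both sides, and multiplicities add under products. *)
Lemma perm_realrootsM p q : p != 0 -> q != 0 ->
  perm_eq (realroots (p * q)) (realroots p ++ realroots q).
Proof.
move=> p0 q0; rewrite /perm_eq; apply/allP => x _ /=.
by rewrite count_cat !count_realroots ?mulf_neq0 // mupM.
Qed.

Lemma perm_realroots_XsubCX x n : perm_eq (realroots (('X - x%:P) ^+ n)) (nseq n x).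
Proof.
rewrite /perm_eq; apply/allP => y _ /=.
rewrite count_realroots ?expf_neq0 ?polyXsubC_eq0 // count_nseq mup_XsubCX.
by rewrite /= (eq_sym x); case: (y == x); rewrite ?mul1n ?mul0n.
Qed.

Lemma perm_realroots_prod I (r : seq I) (F : I -> {poly R}) :
    (forall i, F i != 0) ->
  perm_eq (realroots (\prod_(i <- r) F i)) (flatten [seq realroots (F i) | i <- r]).
Proof.
move=> F0; elim: r => [|i r IHr]; first by rewrite big_nil /realroots rootsRC.
rewrite big_cons (perm_trans (perm_realrootsM _ _)) //.
  by elim/big_ind: _ => [|u v u0 v0|//]; rewrite ?oner_neq0 ?mulf_neq0.
by rewrite perm_cat2l.
Qed.

Lemma perm_realroots_prod_XsubC s : perm_eq (realroots (\prod_(x <- s) ('X - x%:P))) s.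
Proof.
rewrite (perm_trans (perm_realroots_prod _ _)) // => [i|]; first by rewrite polyXsubC_eq0.
have -> : s = flatten [seq [:: x] | x <- s] by elim: s => //= x s {1}->.
elim: {+}s => //= x s' IHs; rewrite -[x :: _]/([:: x] ++ _) perm_cat //.
exact: (perm_realroots_XsubCX _ 1).
Qed.

(** A divisor of a split polynomial is, up to a nonzero constant, a subproduct of its linear
    factors, so it splits as well. This is how the quartics get their four real roots without being
    solved. *)
Lemma size_realroots_dvd p s :
  p %| \prod_(x <- s) ('X - x%:P) -> size (realroots p) = (size p).-1.
Proof.
move=> /dvdp_prod_XsubC[m /eqpf_eq[c c0 ->]].
set q := \prod_(_ <- _) _; have q0: q != 0 by rewrite monic_neq0 ?monic_prod_XsubC.
rewrite -mul_polyC (perm_size (perm_realrootsM _ _)) ?polyC_eq0 //.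
rewrite mul_polyC size_scale // {1}/realroots rootsRC /=.
by rewrite (perm_size (perm_realroots_prod_XsubC _)) size_prod_XsubC.
Qed.

(** Used to recognise the largest eigenvalue of a regular graph as the head of its spectrum. *)
Lemma sorted_realroots p : sorted >=%R (realroots p).
Proof.
rewrite sorted_pairwise /realroots; last exact: ge_trans.
have: pairwise >%R (rev (rootsR p)).
  rewrite -sorted_pairwise; first by rewrite rev_sorted; exact: sorted_roots.
  by move=> y x z xy yz; exact: lt_trans yz xy.
elim: (rev _) => //= y s IHs /andP[/allP ys /IHs ps].
rewrite pairwise_cat ps andbT; apply/andP; split.
  apply/allrelP => u v; rewrite mem_nseq => /andP[_ /eqP->].
  by move=> /flattenP[_ /mapP[z /ys/ltW yz ->]]; rewrite mem_nseq => /andP[_ /eqP->].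
by elim: (mup _ _) => //= k ->; rewrite andbT all_nseq /= lexx orbT.
Qed.

End RealRoots.

(** * Real spectra of symmetric matrices *)

Section SymmetricMatrix.
Variables (R : rcfType) (n : nat) (M : 'M[R]_n).
Hypothesis M_sym : M^T = M.

(** For a row eigenvector [v] with [N = v v^*], the number [z N = v M v^*] is fixed by conjugation
    because [M] is real and symmetric. Since [N] is real and nonzero, [z] is real. *)
Lemma root_char_poly_sym (z : R[i]) :
  root (char_poly (map_mx (real_complex R) M)) z -> z = (complex.Re z)%:C%C.
Proof.
rewrite -eigenvalue_root_char => /eigenvalueP[v vM v0].
pose N := \sum_i v 0 i * (v 0 i)^*.
have N0: N != 0.
  rewrite psumr_eq0 => [|i _]; last exact: mul_conjC_ge0.
  apply: contra v0 => /allP v0; apply/eqP/rowP => i; rewrite mxE; apply/eqP.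
  by rewrite -mul_conjC_eq0; apply: v0; rewrite mem_index_enum.
have zN: z * N = \sum_j \sum_i v 0 i * (M i j)%:C%C * (v 0 j)^*.
  rewrite mulr_sumr; apply: eq_bigr => j _; rewrite mulrA.
  have /rowP/(_ j) := vM; rewrite !mxE => <-; rewrite mulr_suml.
  by apply: eq_bigr => i _; rewrite !mxE.
have NR: N^* = N.
  by rewrite rmorph_sum; apply: eq_bigr => i _; rewrite rmorphM /= conjCK mulrC.
have: (z * N)^* = z * N.
  rewrite {1}zN rmorph_sum /= zN exchange_big /=; apply: eq_bigr => j _.
  rewrite rmorph_sum /=; apply: eq_bigr => i _; rewrite !rmorphM /= conjCK.
  have Mr: (M i j)%:C%C \is Num.real by rewrite complex_real.
  by rewrite (conj_Creal Mr) -{1}M_sym mxE; ring.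
rewrite rmorphM /= NR => /(mulIf N0) => zR.
by rewrite RRe_real // CrealE; apply/eqP.
Qed.

(** The polynomial splits over [R[i]] with real roots only, and the factorization descends along the
    injective embedding of [R]. *)
Lemma char_poly_sym : char_poly M = \prod_(x <- spectrum M) ('X - x%:P).
Proof.
have [rs] := closed_field_poly_normal (char_poly (map_mx (real_complex R) M)).
rewrite (monicP (char_poly_monic _)) scale1r => rsE.
have rsR : rs = map (real_complex R) (map (@complex.Re R) rs).
  rewrite -map_comp -[LHS]map_id; apply/eq_in_map => z zrs /=.
  by apply: root_char_poly_sym; rewrite rsE root_prod_XsubC.
suff E: char_poly M = \prod_(x <- map (@complex.Re R) rs) ('X - x%:P).
  rewrite {1}E; apply: perm_big; rewrite perm_sym /spectrum E.
  exact: perm_realroots_prod_XsubC.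
apply: (map_poly_inj (real_complex R)).
rewrite map_char_poly rsE rmorph_prod /= {1}rsR !big_map.
by apply: eq_bigr => z _; rewrite map_polyXsubC.
Qed.

Lemma size_spectrum : size (spectrum M) = n.
Proof.
by apply/eqP; rewrite -eqSS -(size_prod_XsubC _ id) -char_poly_sym size_char_poly.
Qed.

Lemma mem_spectrum x : (x \in spectrum M) = eigenvalue M x.
Proof. by rewrite eigenvalue_root_char char_poly_sym root_prod_XsubC. Qed.
End SymmetricMatrix.

(** * Schur complements and rank-one perturbations *)

Section Determinants.
Variable F : fieldType.

(** Right multiplication by the unipotent matrix [L] clears the lower left block and leaves the
    Schur complement of [D]. *)
Lemma det_block_schur_dr m n (A : 'M[F]_m) (B : 'M_(m, n)) C (D : 'M_n) :
  D \in unitmx ->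
  \det (block_mx A B C D) = \det D * \det (A - B *m invmx D *m C).
Proof.
move=> Du; pose L : 'M[F]_(m + n) := block_mx 1%:M 0 (- (invmx D *m C)) 1%:M.
have detL : \det L = 1 by rewrite det_lblock !det1 mulr1.
rewrite -[LHS]mulr1 -detL -det_mulmx mulmx_block !mulmx0 !mulmx1 !add0r.
rewrite !mulmxN !mulmxA mulmxV // mul1mx subrr.
by rewrite det_ublock mulrC.
Qed.

Lemma det_block_schur_scalar m n (q : F) (B : 'M_(m, n)) C (D : 'M_n) :
  q != 0 ->
  \det (block_mx q%:M B C D) = q ^+ m * \det (D - q^-1 *: (C *m B)).
Proof.
move=> q0; pose L : 'M[F]_(m + n) := block_mx 1%:M (- (q^-1 *: B)) 0 1%:M.
have detL : \det L = 1 by rewrite det_ublock !det1 mulr1.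
rewrite -[LHS]mulr1 -detL -det_mulmx mulmx_block !mulmx0 !mulmx1 !addr0.
rewrite mulmxN -scalemxAr mul_scalar_mx scalerA mulVf // scale1r addNr.
by rewrite det_lblock det_scalar mulmxN -scalemxAr addrC.
Qed.

(** Both sides come from the two Schur complements of one block matrix with diagonal blocks [1] and
    [p]. Powers on both sides avoid comparing [m] with [n]. *)
Lemma sylvester_det m n (p : F) (B : 'M_(n, m)) (C : 'M_(m, n)) : p != 0 ->
  p ^+ n * \det (p%:M - C *m B) = p ^+ m * \det (p%:M - B *m C).
Proof.
move=> p0; have pu : (p%:M : 'M_m) \in unitmx by rewrite unitmxE det_scalar unitfE expf_neq0.
have := det_block_schur_dr 1%:M B C pu.
rewrite det_block_schur_scalar ?oner_neq0 // expr1n mul1r invr1 scale1r => ->.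
rewrite det_scalar invmx_scalar mul_mx_scalar -scalemxAl mulrCA -detZ.
by rewrite scalerBr scalerA mulfV // scale1r scale_scalar_mx mulr1.
Qed.

(** A constant matrix is a column times a row, so Sylvester's identity reduces the determinant to
    size one. *)
Lemma det_scalar_sub_const n (p k : F) : p != 0 ->
  p * \det (p%:M - const_mx k : 'M_n) = p ^+ n * (p - k * n%:R).
Proof.
move=> p0.
have -> : const_mx k = (const_mx k : 'cV_n) *m (const_mx 1 : 'rV_n).
  by apply/matrixP => i j; rewrite !mxE big_ord1 !mxE mulr1.
have := @sylvester_det n 1 p (const_mx 1) (const_mx k) p0.
rewrite expr1 => ->; congr (_ * _).
rewrite det_mx11 !mxE; congr (_ - _).
by under eq_bigr do rewrite !mxE mul1r; rewrite sumr_const card_ord mulr_natr.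
Qed.

(* [(x - A) (1 + k J) = x - A + k (x - t) J] and [det (1 + k J) = 1 + k n]. *)
Lemma det_char_add_const n (A : 'M[F]_n) (t x e : F) :
    A *m const_mx 1 = const_mx t :> 'cV_n -> x != t ->
  (x - t) * \det (x%:M - A + const_mx e) = (x - t + e * n%:R) * \det (x%:M - A).
Proof.
move=> At xt; have xt0 : x - t != 0 by rewrite subr_eq0.
pose k := e / (x - t).
have -> : x%:M - A + const_mx e = (x%:M - A) *m (1%:M - const_mx (- k)).
  rewrite mulmxBr mulmx1; congr (_ + _); rewrite mulmxBl mul_scalar_mx.
  have -> : const_mx (- k) = (- k) *: ((const_mx 1 : 'cV[F]_n) *m (const_mx 1 : 'rV_n)).
    by apply/matrixP => i j; rewrite !mxE big_ord1 !mxE !mulr1.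
  rewrite -scalemxAr mulmxA At; apply/matrixP => i j; rewrite !mxE !big_ord1 !mxE.
  by rewrite /k; field.
rewrite det_mulmx.
have /= := @det_scalar_sub_const n 1 (- k) (oner_neq0 _).
rewrite expr1n !mul1r => ->; rewrite /k; field.
by [].
Qed.

(** Rows and columns undergo the same permutation, so the two signs cancel. This allows the vertices
    of the join to be listed in block order. *)
Lemma det_enum_reindex (T : finType) (f : T -> T -> F) p (g : 'I_p -> T) :
  bijective g ->
  \det (\matrix_(i < #|T|, j < #|T|) f (enum_val i) (enum_val j)) =
  \det (\matrix_(i < p, j < p) f (g i) (g j)).
Proof.
move=> gb; have Ep : p = #|T| by rewrite -(bij_eq_card gb) card_ord.
move: g gb; rewrite Ep => g gb.
have si : injective (fun i => enum_rank (g i)).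
  by move=> i j /enum_rank_inj; exact: (bij_inj gb).
pose s := perm si.
pose M := \matrix_(i < #|T|, j < #|T|) f (enum_val i) (enum_val j).
have -> : \matrix_(i, j) f (g i) (g j) = row_perm s (col_perm s M).
  by apply/matrixP => i j; rewrite !mxE !permE !enum_rankK.
rewrite row_permE col_permE !det_mulmx !det_perm mulrCA -signr_addb.
by rewrite odd_permV addbb mulr1.
Qed.

End Determinants.

(** * Evaluation of polynomials and finite sums *)

Lemma horner_char_poly (F : fieldType) n (M : 'M[F]_n) x :
  (char_poly M).[x] = \det (x%:M - M).
Proof.
rewrite -horner_evalE -det_map_mx; congr (\det _).
apply/matrixP => i j; rewrite !mxE /= horner_evalE hornerD hornerN hornerC hornerMn hornerX.
by [].
Qed.

(** Otherwise [d * (p - q)] would be a nonzero polynomial vanishing everywhere, in particular at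
    more distinct natural numbers than its degree. *)
Lemma eq_poly_generic (F : numFieldType) (p q d : {poly F}) : d != 0 ->
  (forall x, d.[x] != 0 -> p.[x] = q.[x]) -> p = q.
Proof.
move=> d0 pq; apply/eqP; rewrite -subr_eq0; apply: contraT => pq0.
have r0 : d * (p - q) != 0 by rewrite mulf_neq0.
pose rs := [seq i%:R : F | i <- iota 0 (size (d * (p - q)))].
pose k := size (d * (p - q)); suff: (size rs < k)%N by rewrite size_map size_iota ltnn.
apply: max_poly_roots => //.
  apply/allP => x _; rewrite rootE !hornerE.
  have [d0x|] := boolP (d.[x] == 0); first by rewrite (eqP d0x) mul0r.
  by move=> /pq->; rewrite subrr mulr0.
by rewrite map_inj_uniq ?iota_uniq //; exact: mulrIn (oner_neq0 _).
Qed.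

Lemma sum_enum_val (V : nmodType) (T : finType) (F : T -> V) :
  \sum_(i < #|T|) F (enum_val i) = \sum_x F x.
Proof.
by rewrite [RHS](reindex (fun i : 'I_#|T| => enum_val i)) //; exact: onW_bij (enum_val_bij T).
Qed.

Lemma sum_nat_pred (T : finType) (P : pred T) : (\sum_x P x = #|[set x | P x]|)%N.
Proof. by rewrite -sum1dep_card [RHS]big_mkcond; apply: eq_bigr => x _; case: (P x). Qed.

(** * Counting incidences between vertices and edges *)

Section GraphCounting.
Variable G : sgraph.
Implicit Types (x y : G) (A B : edge G).

Lemma degreeE x : degree x = (\sum_y adj x y)%N.
Proof. by rewrite sum_nat_pred. Qed.

Lemma adj_neq x y : adj x y -> x != y.
Proof. by apply: contraTneq => ->; rewrite adj_irrefl. Qed.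

Lemma edgesP (A : {set G}) :
  reflect (exists x y, adj x y /\ A = [set x; y]) (A \in edges G).
Proof.
rewrite inE; apply: (iffP existsP) => [[x /existsP[y /andP[xy /eqP->]]]|[x [y [xy ->]]]].
  by exists x, y.
by exists x; apply/existsP; exists y; rewrite xy eqxx.
Qed.

Lemma card_edge A : #|val A| = 2.
Proof. by have /edgesP[x [y [/adj_neq xy ->]]] := valP A; rewrite cards2 xy. Qed.

Lemma card_edgeE : #|edge G| = #|edges G|.
Proof. by rewrite card_sig. Qed.

Lemma edge_pair A x y : x != y -> x \in val A -> y \in val A -> val A = [set x; y].
Proof.
move=> xy xA yA; apply/esym/eqP; rewrite eqEcard cards2 xy card_edge leqnn andbT.
by apply/subsetP => z /set2P[]->.
Qed.

(** Two common vertices determine an edge, so distinct edges share at most one. The last summand is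
    adjacency of new vertices in the Q-graph. *)
Lemma card_edgeI A B :
  #|val A :&: val B| = ((A == B) * 2 + ((A != B) && (val A :&: val B != set0)))%N.
Proof.
have [->|AB] := eqVneq; first by rewrite setIid card_edge.
rewrite mul0n add0n -card_gt0; set S := _ :&: _.
suff: (#|S| <= 1)%N by case: #|S| => [|[]].
rewrite leqNgt; apply: contra AB => /card_gt1P[x [y [xS yS xy]]].
move: xS yS; rewrite !inE => /andP[xA xB] /andP[yA yB].
by apply/eqP/val_inj; rewrite (edge_pair xy xA yA) (edge_pair xy xB yB).
Qed.

Lemma card_edges_sub (P : pred {set G}) :
  #|[set A : edge G | P (val A)]| = #|[set S in edges G | P S]|.
Proof.
rewrite -(card_imset _ val_inj); congr #|pred_of_set _|; apply/setP => S.
apply/imsetP/setIdP => [[A]|[SE PS]]; first by rewrite inE => PA ->; split=> //; exact: valP.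
by exists (Sub S SE); rewrite ?inE.
Qed.

(** The entries of [B B^T = D + A]: edges at [x] correspond to neighbours of [x], while only the
    edge joining two distinct vertices can contain both. *)
Lemma sum_edges_pair x y :
  (\sum_(A : edge G) (x \in val A) * (y \in val A) = (x == y) * degree x + adj x y)%N.
Proof.
under eq_bigr do rewrite mulnb.
rewrite sum_nat_pred (card_edges_sub (fun S : {set G} => (x \in S) && (y \in S))).
have [<-|xy] := eqVneq x y.
  rewrite adj_irrefl mul1n addn0 /degree; set N := [set z | adj x z].
  rewrite -(@card_in_imset _ _ (fun z => [set x; z]) (mem N)).
    congr #|pred_of_set _|; apply/setP => S; apply/setIdP/imsetP; rewrite andbb.
      case=> /edgesP[u [v [uv ->]]] /set2P[]xE.
        by exists v; rewrite ?inE xE.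
      by exists u; rewrite ?inE xE 1?adj_sym // setUC.
    case=> z; rewrite inE => xz ->; rewrite set21; split=> //.
    by apply/edgesP; exists x, z.
  move=> u v; rewrite !inE => /adj_neq xu _ /setP/(_ u).
  by rewrite !inE eqxx orbT eq_sym (negPf xu) => /esym/eqP.
rewrite mul0n add0n; have [e|/negPf e] := boolP (adj x y).
  rewrite (_ : [set _ in _ | _] = [set [set x; y]]) ?cards1 //.
  apply/setP => S; rewrite in_set1; apply/setIdP/eqP => [[SE /andP[xS yS]]|->].
    exact: (@edge_pair (Sub S SE)).
  by rewrite set21 set22; split=> //; apply/edgesP; exists x, y.
apply: eq_card0 => S; apply/negP => /setIdP[/edgesP[u [v [uv ->]]]].
case/andP=> /set2P[]? /set2P[]?; subst; last 1 first.
- by rewrite eqxx in xy.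
- by rewrite eqxx in xy.
- by rewrite uv in e.
- by rewrite adj_sym uv in e.
Qed.

Lemma sum_edges_degree x : (\sum_(A : edge G) (x \in val A) = degree x)%N.
Proof.
have := sum_edges_pair x x; rewrite eqxx adj_irrefl mul1n addn0 => <-.
by apply: eq_bigr => A _; rewrite mulnb andbb.
Qed.

Variable t : nat.
Hypothesis G_regular : regular G t.

(** Incidences are counted from the two ends of [A], each on [t] edges. The edge [A] itself is met
    twice, whence the [2], placed on the left to avoid truncated subtraction. *)
Lemma sum_edges_inter A :
  (\sum_(B : edge G) ((A != B) && (val A :&: val B != set0)) + 2 = 2 * t)%N.
Proof.
have <- : (\sum_(B : edge G) #|val A :&: val B| = 2 * t)%N.
  under eq_bigr do rewrite -cardsE -sum_nat_pred.
  under eq_bigr do under eq_bigr do rewrite inE -mulnb.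
  rewrite exchange_big /=; under eq_bigr do rewrite -big_distrr /= sum_edges_degree G_regular.
  by rewrite -big_distrl sum_nat_pred cardsE card_edge.
under [RHS]eq_bigr do rewrite card_edgeI.
rewrite big_split addnC /=; congr (_ + _)%N.
rewrite (bigD1 A) //= eqxx big1 ?addn0 // => B.
by rewrite eq_sym => /negPf->.
Qed.

Lemma regular_handshake : (2 * #|edge G| = #|G| * t)%N.
Proof.
transitivity (\sum_(x : G) \sum_(A : edge G) (x \in val A))%N.
  rewrite exchange_big /= .
  under eq_bigr do rewrite sum_nat_pred cardsE card_edge.
  by rewrite sum_nat_const mulnC.
by rewrite -sum_nat_const; apply: eq_bigr => x _; rewrite sum_edges_degree.
Qed.

End GraphCounting.

(** * Vertex degrees in the join *)

Section QJoinDegree.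
Variables (G1 G2 : sgraph) (t : nat).
Hypothesis G1_regular : regular G1 t.

Lemma degree_Qjoin_old (x : G1) : degree (inl (inl x) : Qedge_join G1 G2) = t.
Proof.
rewrite degreeE !big_sumType /= !big1_eq addn0 add0n -(G1_regular x).
exact: sum_edges_degree.
Qed.

(** A new vertex sees its two old ends, [2 t - 2] new vertices and all of [G2]. *)
Lemma degree_Qjoin_new (A : edge G1) :
  degree (inl (inr A) : Qedge_join G1 G2) = (2 * t + #|G2|)%N.
Proof.
rewrite degreeE !big_sumType /= sum1_card -(sum_edges_inter G1_regular A).
by rewrite sum_nat_pred cardsE card_edge [(2 + _)%N]addnC.
Qed.

Lemma degree_Qjoin_right (y : G2) :
  degree (inr y : Qedge_join G1 G2) = (#|edge G1| + degree y)%N.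
Proof.
by rewrite degreeE !big_sumType /= big1_eq add0n sum1_card degreeE.
Qed.

End QJoinDegree.

Lemma degree_Kab_inl a b (i : 'I_a) : degree (inl i : Kab a b) = b.
Proof. by rewrite degreeE big_sumType /= big1_eq add0n sum1_card card_ord. Qed.

Lemma degree_Kab_inr a b (i : 'I_b) : degree (inr i : Kab a b) = a.
Proof. by rewrite degreeE big_sumType /= big1_eq addn0 sum1_card card_ord. Qed.

Lemma card_Kab a b : #|Kab a b| = (a + b)%N.
Proof. by rewrite card_sum !card_ord. Qed.

(** * The incidence matrix of a regular graph *)

Section Incidence.
Variables (R : comNzRingType) (G : sgraph) (t : nat).
Hypothesis G_regular : regular G t.

Definition incmx : 'M[R]_(#|G|, #|edge G|) :=
  \matrix_(i, j) ((enum_val i : G) \in val (enum_val j : edge G))%:R.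

Lemma incmx_mul_tr : incmx *m incmx^T = t%:R%:M + adjmx G R.
Proof.
apply/matrixP => i j; rewrite !mxE; under eq_bigr do rewrite !mxE -natrM.
rewrite -natr_sum.
rewrite (sum_enum_val (fun A : edge G => (enum_val i \in val A) * (enum_val j \in val A))%N).
by rewrite sum_edges_pair G_regular (inj_eq enum_val_inj) natrD natrM mulr_natl.
Qed.

(** Off the diagonal this is the adjacency matrix of the line graph, that is, of the new
    vertices. *)
Lemma tr_incmx_mul (i j : 'I_#|edge G|) :
  (incmx^T *m incmx) i j =
  ((i == j) * 2 +
   ((i != j) && (val (enum_val i : edge G) :&: val (enum_val j : edge G) != set0)))%:R.
Proof.
rewrite mxE; under eq_bigr do rewrite !mxE -natrM.
rewrite -natr_sum -(inj_eq (@enum_val_inj _ _) i) -card_edgeI; congr (_%:R).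
rewrite (sum_enum_val (fun x : G => (x \in val (enum_val i : edge G)) * (x \in val (enum_val j : edge G)))%N).
by under eq_bigr do rewrite mulnb; rewrite sum_nat_pred.
Qed.

(** Every edge has two ends. With the transposed version below, this lets constant blocks factor
    through the incidence matrix. *)
Lemma tr_incmx_mul_const (k : R) p :
  incmx^T *m (const_mx k : 'M_(_, p)) = const_mx (2 * k).
Proof.
apply/matrixP => i j; rewrite !mxE; under eq_bigr do rewrite !mxE.
rewrite -mulr_suml -natr_sum; congr (_%:R * _).
rewrite (sum_enum_val (fun x : G => x \in val (enum_val i : edge G) : nat)).
by rewrite sum_nat_pred cardsE card_edge.
Qed.

Lemma const_mul_incmx (k : R) p :
  (const_mx k : 'M_(p, _)) *m incmx = const_mx (2 * k).
Proof.
by apply: trmx_inj; rewrite trmx_mul !trmx_const tr_incmx_mul_const.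
Qed.

Lemma AalphaE (alpha : R) :
  Aalpha G alpha = (alpha * t%:R)%:M + (1 - alpha) *: adjmx G R.
Proof.
by apply/matrixP => i j; rewrite !mxE G_regular -mulrnAr.
Qed.

Lemma const_mul_adjmx (k : R) p :
  (const_mx k : 'M_(p, _)) *m adjmx G R = const_mx (t%:R * k).
Proof.
apply/matrixP => i j; rewrite !mxE; under eq_bigr do rewrite !mxE adj_sym.
rewrite -mulr_sumr -natr_sum (sum_enum_val (fun y : G => adj (enum_val j : G) y : nat)).
by rewrite -degreeE G_regular mulrC.
Qed.

Lemma tr_adjmx : (adjmx G R)^T = adjmx G R.
Proof. by apply/matrixP => i j; rewrite !mxE adj_sym. Qed.

Lemma Aalpha_const (alpha : R) :
  Aalpha G alpha *m const_mx 1 = const_mx t%:R :> 'cV_#|G|.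
Proof.
rewrite AalphaE mulmxDl mul_scalar_mx -scalemxAl.
rewrite -[adjmx _ _]tr_adjmx -[const_mx 1]trmx_const -trmx_mul const_mul_adjmx.
by apply/matrixP => i j; rewrite !mxE; ring.
Qed.

End Incidence.

Section Symmetry.
Variables (R : comNzRingType) (G : sgraph) (alpha : R).
Lemma Aalpha_sym : (Aalpha G alpha)^T = Aalpha G alpha.
Proof.
apply/matrixP => i j; rewrite !mxE adj_sym eq_sym; congr (_ * _ + _).
by case: eqP => [->|].
Qed.
End Symmetry.

Lemma mul_const_mx (R : comNzRingType) m n p (x y : R) :
  (const_mx x : 'M_(m, n)) *m (const_mx y : 'M_(n, p)) = const_mx (x * y * n%:R).
Proof.
apply/matrixP => i j; rewrite !mxE; under eq_bigr do rewrite !mxE.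
by rewrite sumr_const card_ord mulr_natr.
Qed.

(** * Determinant and coronal of the complete bipartite block *)

Section CoronalKab.
Variables (F : fieldType) (a b : nat) (beta zl zr : F).
Let den := zl * zr - beta ^+ 2 * a%:R * b%:R.

(** This is the block of [nu - A_alpha] on the vertices of K_(a,b) inside the join. The diagonal
    values [zl] and [zr] of the two parts stay free parameters. *)
Definition resolvent_Kab : 'M[F]_(a + b) :=
  block_mx zl%:M (const_mx (- beta)) (const_mx (- beta)) zr%:M.

(** Eliminating the first part leaves a scalar matrix minus a constant one on the second. *)
Lemma det_resolvent_Kab : (0 < a)%N -> (0 < b)%N -> zl != 0 -> zr != 0 ->
  \det resolvent_Kab = zl ^+ (a - 1) * zr ^+ (b - 1) * den.
Proof.
move=> a0 b0 zl0 zr0; rewrite /resolvent_Kab det_block_schur_scalar //.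
have -> : zl^-1 *: ((const_mx (- beta) : 'M_(b, a)) *m (const_mx (- beta) : 'M_(a, b)))
     = const_mx (zl^-1 * (beta ^+ 2 * a%:R)).
  by rewrite mul_const_mx mulrNN -expr2; apply/matrixP => i j; rewrite !mxE.
apply: (mulfI zr0); rewrite mulrCA det_scalar_sub_const // /den.
case: a b a0 b0 => [|a'] [|b'] // _ _; rewrite !subn1 /= !exprS.
by field.
Qed.

Lemma resolvent_Kab_const k : den != 0 ->
  resolvent_Kab *m col_mx (const_mx ((zr + beta * b%:R) / den))
                          (const_mx ((zl + beta * a%:R) / den))
  = const_mx 1 :> 'M_(_, k).
Proof.
move=> den0; rewrite /resolvent_Kab mul_block_col !mul_scalar_mx -[RHS]vsubmxK.
rewrite !mul_const_mx.
by congr col_mx; apply/matrixP => i j; rewrite !mxE; move: den0; rewrite /den => ?; field.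
Qed.

End CoronalKab.

(** * Block form of the characteristic matrix of the join *)

Section QJoinBlock.
Variables (F : numFieldType) (alpha nu : F) (G : sgraph) (t a b : nat).
Hypothesis G_regular : regular G t.
Let n := #|G|.
Let m := #|edge G|.
Let beta := 1 - alpha.
Let q := nu - alpha * t%:R.
Let p := nu - alpha * (2 * t%:R + (a + b)%:R + 2) + 2.
Let zl := nu - alpha * (m%:R + b%:R).
Let zr := nu - alpha * (m%:R + a%:R).
Let B := incmx F G.

(** Lists old vertices, new vertices, then the two parts of K_(a,b), matching the nested blocks. *)
Definition Qjoin_index (i : 'I_((n + m) + (a + b))) : Qedge_join G (Kab a b) :=
  match split i with
  | inl j => inl (match split j with
                  | inl x => inl (enum_val x)
                  | inr A => inr (enum_val A)
                  end)
  | inr k => inr (split k)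
  end.

Lemma Qjoin_index_bij : bijective Qjoin_index.
Proof.
apply: inj_card_bij; last by rewrite !card_sum !card_ord.
have spI m1 m2 := can_inj (@splitK m1 m2).
move=> i j; rewrite /Qjoin_index => E; apply: (spI _ _); move: E.
case: (split i) => i'; case: (split j) => j' // [] E; congr (_ _); apply: (spI _ _) => //.
by move: E; case: (split i') => k; case: (split j') => l // [] /enum_val_inj->.
Qed.

Lemma char_poly_Qjoin_block :
  (char_poly (Aalpha (Qedge_join G (Kab a b)) alpha)).[nu] =
  \det (block_mx
          (block_mx q%:M (- beta *: B) (- beta *: B^T) (p%:M - beta *: (B^T *m B)))
          (col_mx 0 (const_mx (- beta)))
          (row_mx 0 (const_mx (- beta)))
          (resolvent_Kab a b beta zl zr)).
Proof.
pose f (u v : Qedge_join G (Kab a b)) : F :=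
  nu *+ (u == v) - (alpha * ((degree u)%:R *+ (u == v)) + beta * (adj u v)%:R).
transitivity (\det (\matrix_(i < #|Qedge_join G (Kab a b)|, j < #|Qedge_join G (Kab a b)|) f (enum_val i) (enum_val j))).
  rewrite horner_char_poly; congr (\det _); apply/matrixP => i j; rewrite !mxE.
  by rewrite /f (inj_eq enum_val_inj).
rewrite (det_enum_reindex f Qjoin_index_bij); congr (\det _).
apply/matrixP => i j; rewrite [LHS]mxE /Qjoin_index [RHS]mxE.
case: (split i) => i1; rewrite [RHS]mxE; case: (split j) => j1 /=.
- rewrite [RHS]mxE; case: (split i1) => i2; rewrite [RHS]mxE; case: (split j1) => j2.
  + rewrite /f (degree_Qjoin_old _ G_regular) mxE /= (inj_eq (@inl_inj _ _)) (inj_eq (@inl_inj _ _)).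
    rewrite (inj_eq enum_val_inj) /q.
    by case: (i2 == j2); rewrite !(mulr0n, mulr1n); ring.
  + by rewrite /f !mxE /= !mulr0n; ring.
  + by rewrite /f !mxE /= !mulr0n; ring.
  (* The diagonal of [B^T B] is [2], so [p] exceeds the diagonal entry [nu - alpha * (2 t + a + b)]
     by [2 * beta]. This makes [p] the linear factor of item (b)(i). *)
  + have -> : (p%:M - beta *: (B^T *m B)) i2 j2 = p *+ (i2 == j2) - beta * (B^T *m B) i2 j2.
      by rewrite !mxE.
    rewrite tr_incmx_mul /f (degree_Qjoin_new _ G_regular) /=.
    rewrite (inj_eq (@inl_inj _ _)) (inj_eq (@inr_inj _ _)) !(inj_eq enum_val_inj).
    rewrite card_Kab /p; case: eqP => _ /=; rewrite ?(mulr0n, mulr1n) ?addn0; last by ring.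
    by rewrite !(natrD, natrM) /beta; ring.
- by rewrite [RHS]mxE; case: (split i1) => i2; rewrite mxE /f /= !mulr0n; ring.
- by rewrite [RHS]mxE; case: (split j1) => j2; rewrite mxE /f /= !mulr0n; ring.
- rewrite /f (inj_eq (@inr_inj _ _)) degree_Qjoin_right [RHS]mxE.
  case: (split i1) => [i2|i2]; rewrite [RHS]mxE; case: (split j1) => [j2|j2];
    rewrite mxE /= ?degree_Kab_inl ?degree_Kab_inr ?(inj_eq (@inl_inj _ _)) ?(inj_eq (@inr_inj _ _)).
  + by case: (i2 == j2); rewrite ?(mulr0n, mulr1n) ?natrD /zl -/m; ring.
  + by rewrite !mulr0n; ring.
  + by rewrite !mulr0n; ring.
  + by case: (i2 == j2); rewrite ?(mulr0n, mulr1n) ?natrD /zr -/m; ring.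
Qed.

End QJoinBlock.

(** * The characteristic polynomial at a generic value *)

Section GenericValue.
Variables (F : numFieldType) (alpha nu : F) (G : sgraph) (t a b : nat).
Hypothesis G_regular : regular G t.
Let n := #|G|.
Let m := #|edge G|.
Let beta := 1 - alpha.
Let q := nu - alpha * t%:R.
Let p := nu - alpha * (2 * t%:R + (a + b)%:R + 2) + 2.
Let zl := nu - alpha * (m%:R + b%:R).
Let zr := nu - alpha * (m%:R + a%:R).
Let den := zl * zr - beta ^+ 2 * a%:R * b%:R.
Let num := a%:R * (zr + beta * b%:R) + b%:R * (zl + beta * a%:R).
Let B := incmx F G.
(** The quadratic of item (b)(iv) at an eigenvalue [x], written in the quantities produced by the
    Schur complements. *)
Let quad x := p * q - (q + beta) * ((1 - 2 * alpha) * t%:R + x).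

(* [sigma] carries the coronal of K_(a,b), the sum of the entries of its resolvent. *)
Lemma det_Qgraph_part (sigma : F) : q != 0 -> p != 0 ->
  let d := (q + beta) / q in
  p ^+ n * \det (block_mx q%:M (- beta *: B) (- beta *: B^T)
      (p%:M - beta *: (B^T *m B) - const_mx sigma)) =
  q ^+ n * p ^+ m *
   \det ((p + d * alpha * t%:R - d * t%:R * beta)%:M - d *: Aalpha G alpha
          - const_mx (sigma * t%:R / 2)).
Proof.
move=> q0 p0 d; rewrite det_block_schur_scalar //.
(* [W] is chosen so that [B^T W B] collects all that is subtracted from [p]: the coefficient of
   [B^T B] is [beta + beta^2 / q = beta * d], and the [4] compensates for two ends on each side. *)
pose W : 'M[F]_n := (beta * d)%:M + const_mx (sigma / 4).
have WB : W *m B = (beta * d) *: B + const_mx (sigma / 2).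
  rewrite /W mulmxDl mul_scalar_mx const_mul_incmx; congr (_ + const_mx _).
  by field.
have -> : p%:M - beta *: (B^T *m B) - const_mx sigma - q^-1 *: ((- beta *: B^T) *m (- beta *: B))
   = p%:M - B^T *m (W *m B).
  rewrite WB mulmxDr -scalemxAr tr_incmx_mul_const -scalemxAl -scalemxAr.
  move: (B^T *m B) => S; apply/matrixP => i j; rewrite !mxE /d.
  by field.
rewrite mulrCA sylvester_det // mulrA; congr (_ * \det _).
(* Here [B B^T = t + A] and [beta A = A_alpha - alpha t]. The columns of [t + A] sum to [2 t], which
   turns [sigma / 4] into [sigma * t / 2]. *)
rewrite -mulmxA (incmx_mul_tr F G_regular) (AalphaE G_regular) /W mulmxDl.
rewrite mul_scalar_mx mulmxDr mul_mx_scalar (const_mul_adjmx G_regular).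
by apply/matrixP => i j; rewrite !mxE -/beta; case: (i == j); rewrite ?(mulr0n, mulr1n); field.
Qed.

(** The eigenvalue [t] is listed apart because the constant perturbation acts along its all-ones
    eigenvector and so changes that factor only. The powers of [p] stay on both sides since [m] may
    be smaller than [n]. *)
Lemma generic_char_poly (s : seq F) :
    (0 < a)%N -> (0 < b)%N ->
    q != 0 -> p != 0 -> zl != 0 -> zr != 0 -> den != 0 -> q + beta != 0 ->
    quad t%:R != 0 ->
    char_poly (Aalpha G alpha) = \prod_(x <- t%:R :: s) ('X - x%:P) ->
  p ^+ n * (char_poly (Aalpha (Qedge_join G (Kab a b)) alpha)).[nu] =
  p ^+ m * zl ^+ (a - 1) * zr ^+ (b - 1) * \prod_(x <- s) quad x *
  (quad t%:R * den - m%:R * beta ^+ 2 * q * num).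
Proof.
move=> a0 b0 q0 p0 zl0 zr0 den0 qb0 quad0 charG.
pose Z := resolvent_Kab a b beta zl zr.
have det_Z : \det Z = zl ^+ (a - 1) * zr ^+ (b - 1) * den by exact: det_resolvent_Kab.
have Zu : Z \in unitmx by rewrite unitmxE det_Z unitfE !mulf_neq0 ?expf_neq0.
pose sigma := beta ^+ 2 * (num / den).
rewrite (char_poly_Qjoin_block alpha nu a b G_regular) det_block_schur_dr // det_Z.
set K := block_mx q%:M _ _ _.
have -> : K - col_mx 0 (const_mx (- beta)) *m invmx Z *m row_mx 0 (const_mx (- beta)) =
    block_mx q%:M (- beta *: B) (- beta *: B^T) (p%:M - beta *: (B^T *m B) - const_mx sigma).
  (* Equal rows make this block a multiple of the all-ones column, so only the image of that column
     under the inverse of [Z] is required. *)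
  have -> : row_mx 0 (const_mx (- beta)) =
      (const_mx 1 : 'cV[F]_(a + b)) *m row_mx (0 : 'rV_n) (const_mx (- beta) : 'rV_m).
    rewrite mul_mx_row mulmx0 mul_const_mx; congr row_mx.
    by apply/matrixP => i j; rewrite !mxE; ring.
  rewrite -(resolvent_Kab_const _ den0) -mulmxA [invmx Z *m _]mulmxA mulKmx //.
  rewrite mulmxA mul_col_mx mul0mx.
  have -> : (const_mx (- beta) : 'M_(m, a + b)) =
      row_mx (const_mx (- beta) : 'M_(m, a)) (const_mx (- beta) : 'M_(m, b)).
    by rewrite row_mx_const.
  rewrite mul_row_col !mul_const_mx mul_col_row !mul0mx mulmx0 -raddfD mul_const_mx.
  rewrite /K opp_block_mx add_block_mx !subr0 /=; congr (block_mx _ _ _ (_ - _)).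
  by apply/matrixP => i j; rewrite !mxE -/den /sigma /num; field.
have := det_Qgraph_part sigma q0 p0; rewrite /=.
set d := (q + beta) / q => detQ.
rewrite mulrCA {}detQ.
have d0 : d != 0 by rewrite mulf_neq0 ?invr_eq0.
(* Extracting the factor [d] leaves the characteristic matrix of [A_alpha] at the point [x], plus
   the constant [e]. *)
pose x := (p - d * (1 - 2 * alpha) * t%:R) / d.
pose e := - (sigma * t%:R / 2) / d.
have -> : (p + d * alpha * t%:R - d * t%:R * beta)%:M - d *: Aalpha G alpha
          - const_mx (sigma * t%:R / 2) = d *: (x%:M - Aalpha G alpha + const_mx e).
  move: (Aalpha _ _) => A; apply/matrixP => i j; rewrite !mxE /x /e /beta.
  by case: (i == j); rewrite ?(mulr0n, mulr1n); field.
rewrite detZ -/n.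
have quadE y : q * d * (x - y) = quad y.
  by rewrite /quad /x /d; field; rewrite q0 -/d /d.
have xt : x != t%:R.
  by apply: contra quad0; rewrite -quadE => /eqP->; rewrite subrr mulr0.
have hs : (2 * m = n * t)%N := regular_handshake G_regular.
have := det_char_add_const e (Aalpha_const G_regular alpha) xt.
rewrite -(horner_char_poly (Aalpha G alpha)) charG big_cons hornerM hornerXsubC.
rewrite mulrCA; have xt0 : x - t%:R != 0 by rewrite subr_eq0.
move=> /(mulfI xt0) ->.
have ns : n = (size s).+1.
  by apply/eqP; rewrite -eqSS -(size_char_poly (Aalpha G alpha)) charG size_prod_XsubC.
have prodE : \prod_(y <- s) quad y = (q * d) ^+ size s * \prod_(y <- s) (x - y).
  under eq_bigr do rewrite -quadE.
  by rewrite big_split /= big_const_seq count_predT iter_mulr_1.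
rewrite horner_prod; under eq_bigr do rewrite hornerXsubC.
(* The handshake identity [n t = 2 m] converts the contribution of [e * n] into one involving
   [m]. *)
have key : q * d * (x - t%:R + e * n%:R) * den = quad t%:R * den - m%:R * beta ^+ 2 * q * num.
  rewrite (mulrDr (q * d)) quadE mulrDl; congr (_ + _); rewrite /e /sigma.
  have hsF : n%:R * t%:R = 2 * m%:R :> F by rewrite -!natrM hs.
  have -> : q * d * (- (beta ^+ 2 * (num / den) * t%:R / 2) / d * n%:R) * den =
      - (q * beta ^+ 2 * num * (n%:R * t%:R) / 2) by field; rewrite den0 d0.
  by rewrite hsF; field.
rewrite -key prodE -/n ns (exprS q) (exprS d) (exprMn _ q d).
move: (q ^+ size s) (d ^+ size s) (p ^+ m) (zl ^+ _) (zr ^+ _) => qs ds pm zla zrb.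
move: (\prod_(y <- s) (x - y)) (x - t%:R + e * _) => pr xe.
by clearbody d q den; ring.
Qed.

End GenericValue.

(** * The spectrum of a regular graph *)

Lemma eigenvalue_le_col_sum (R : realFieldType) n (A : 'M[R]_n) (t x : R) :
    (forall i j, 0 <= A i j) -> (const_mx 1 : 'rV_n) *m A = const_mx t ->
  eigenvalue A x -> x <= t.
Proof.
move=> A0 At /eigenvalueP[v vA v0].
have [k vk0] : exists k, v 0 k != 0.
  by apply/existsP; apply: contraR v0; rewrite negb_exists => /forallP v0;
     apply/eqP/rowP => i; rewrite mxE; apply/eqP; rewrite -[_ == _]negbK.
(* At an entry of maximal modulus, the eigenvector equation bounds [x] by the common column sum. *)
pose i := [arg max_(i > k) `|v 0 i|]%O.
have imax j : `|v 0 j| <= `|v 0 i|.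
  by rewrite /i; case: arg_maxP => // i0 _ le_i0; exact: le_i0.
have vi0 : 0 < `|v 0 i| by apply: lt_le_trans (imax k); rewrite normr_gt0.
apply: le_trans (ler_norm x) _; rewrite -(ler_pM2r vi0) -normrM.
have /rowP/(_ i) := vA; have /rowP/(_ i) := At; rewrite !mxE => <- <-.
rewrite mulr_suml; apply: le_trans (ler_norm_sum _ _ _) _.
apply: ler_sum => j _; rewrite normrM (ger0_norm (A0 _ _)) mxE mul1r mulrC.
by rewrite ler_wpM2l.
Qed.

Section SpectrumRegular.
Variables (R : rcfType) (alpha : R) (G : sgraph) (t : nat).
Hypothesis alpha01 : 0 <= alpha <= 1.
Hypothesis G_regular : regular G t.
Hypothesis G_nonempty : (0 < #|G|)%N.

(** For [alpha] in the unit interval the entries are nonnegative, so no eigenvalue exceeds the row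
    sum [t], itself an eigenvalue. It therefore heads the nonincreasing list. *)
Lemma spectrum_regular :
  spectrum (Aalpha G alpha) =
  t%:R :: [seq lambda (Aalpha G alpha) i | i <- index_iota 2 #|G|.+1].
Proof.
have symA := Aalpha_sym G alpha.
have := size_spectrum symA; have := sorted_realroots (char_poly (Aalpha G alpha)).
have rowA : (const_mx 1 : 'rV_#|G|) *m Aalpha G alpha = const_mx t%:R.
  by rewrite -[Aalpha _ _]symA -[const_mx 1]trmx_const -trmx_mul (Aalpha_const G_regular) trmx_const.
have t_eig : t%:R \in spectrum (Aalpha G alpha).
  rewrite mem_spectrum //; apply/eigenvalueP; exists (const_mx 1).
    by rewrite rowA; apply/matrixP => i j; rewrite !mxE mulr1.
  apply/eqP => /rowP/(_ (Ordinal G_nonempty)) /eqP; rewrite !mxE.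
  by rewrite oner_eq0.
have le_t x : x \in spectrum (Aalpha G alpha) -> x <= t%:R.
  rewrite mem_spectrum //; apply: eigenvalue_le_col_sum rowA.
  have /andP[a0 a1] := alpha01.
  move=> i j; rewrite !mxE addr_ge0 ?mulr_ge0 ?mulrn_wge0 ?ler0n ?subr_ge0 //.
rewrite -/(spectrum _) /lambda; move: t_eig le_t.
case: (spectrum _) => // y s; rewrite in_cons => tys le_t sorted_s size_s.
have yt : y = t%:R.
  apply/eqP; rewrite eq_le le_t ?mem_head //=.
  case/predU1P: tys => [->//|]; apply/allP: t%:R.
  by apply: order_path_min sorted_s; exact: ge_trans.
rewrite yt; congr (_ :: _); apply: (@eq_from_nth _ 0) => [|i i_s].
  by rewrite size_map size_iota -size_s subSS subn1.
(* As [lambda] counts from one, the tail at position [i] is [lambda] at [i + 2]. *)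
by move: i_s; rewrite -size_s /index_iota !subSS subn0 => i_s; rewrite (nth_map 0%N) ?size_iota ?nth_iota.
Qed.

End SpectrumRegular.

(** * The quadratic and quartic factors *)

Section Identity.
Variables (R : rcfType) (alpha : R) (t m a b : nat).

Definition Qjoin_quadratic (x : R) : {poly R} :=
  'X^2 - (alpha * (t%:R + (a + b)%:R + 2) + t%:R - 2 + x) *: 'X
       + (alpha ^+ 2 * t%:R * (a + b)%:R
          + (alpha * (t%:R + 1) - 1) * (t%:R + x))%:P.

(** The size [m] is a free parameter, so that the case of degree one is the instance [t = m = 1]. *)
Definition Qjoin_quartic : {poly R} :=
  ('X^2 - (alpha * t%:R + alpha * (a + b)%:R + 2 * t%:R - 2 + 2 * alpha) *: 'X
     + (alpha ^+ 2 * t%:R * (a + b)%:R + 2 * alpha * t%:R ^+ 2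
        + 2 * alpha * t%:R - 2 * t%:R)%:P)
  * ('X^2 - (2 * alpha * m%:R + alpha * (a + b)%:R) *: 'X
     + (alpha ^+ 2 * m%:R ^+ 2 + alpha ^+ 2 * m%:R * (a + b)%:R
        + 2 * alpha * a%:R * b%:R - a%:R * b%:R)%:P)
  - (m%:R * (1 - alpha) ^+ 2)%:P * ('X - (alpha * t%:R)%:P)
    * (('X - (alpha * m%:R)%:P) * (a + b)%:R%:P
       - (alpha * (a + b)%:R ^+ 2)%:P + (2 * a%:R * b%:R)%:P).

Lemma size_quadratic (c d : R) : size ('X^2 - c *: 'X + d%:P) = 3.
Proof.
rewrite -addrA -scaleNr size_polyDl ?size_polyXn // ltnS.
rewrite (leq_trans (size_polyD _ _)) // geq_max (leq_trans (size_scale_leq _ _)) ?size_polyX //.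
by rewrite (leq_trans (size_polyC_leq1 _)).
Qed.

Lemma quadratic_neq0 (c d : R) : 'X^2 - c *: 'X + d%:P != 0.
Proof. by rewrite -size_poly_eq0 size_quadratic. Qed.

(** The subtracted term has degree at most two, so the product of the two monic quadratics
    dominates. *)
Lemma size_Qjoin_quartic : size Qjoin_quartic = 5.
Proof.
rewrite /Qjoin_quartic size_polyDl size_mul ?quadratic_neq0 ?size_quadratic //.
rewrite size_polyN (leq_ltn_trans (size_polyMleq _ _)) //.
set u := size _; set v := size _.
have u2 : (u <= 2)%N.
  rewrite /u mul_polyC (leq_trans (size_scale_leq _ _)) // size_XsubC //.
have v2 : (v <= 2)%N.
  have szD (f g : {poly R}) : (size f <= 2)%N -> (size g <= 2)%N -> (size (f + g)%R <= 2)%N.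
    by move=> f2 g2; rewrite (leq_trans (size_polyD _ _)) // geq_max f2.
  have szC (c : R) : (size c%:P <= 2)%N by rewrite (leq_trans (size_polyC_leq1 _)).
  rewrite /v szD // szD ?size_polyN //.
  by rewrite mulrC mul_polyC (leq_trans (size_scale_leq _ _)) // size_XsubC.
by move: u2 v2; rewrite /= => u2 v2; lia.
Qed.

End Identity.

(** The trace is [2 * alpha] and the largest eigenvalue is [1]. *)
Lemma lambda2_regular1 (R : rcfType) (alpha : R) (G : sgraph) :
    0 <= alpha <= 1 -> regular G 1 -> #|G| = 2%N ->
  lambda (Aalpha G alpha) 2 = 2 * alpha - 1.
Proof.
move=> alpha01 reg n2; have n0 : (0 < #|G|)%N by rewrite n2.
have trA : \tr (Aalpha G alpha) = 2 * alpha.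
  rewrite (AalphaE reg) mxtraceD mxtrace_scalar mxtraceZ.
  rewrite [\tr (adjmx _ _)]big1 => [|i _]; last by rewrite mxE adj_irrefl.
  by rewrite n2; ring.
have := char_poly_trace (Aalpha G alpha) n0.
rewrite trA char_poly_sym ?Aalpha_sym // (spectrum_regular alpha01 reg n0).
move: (lambda _) => l; rewrite n2 /index_iota /= !big_cons big_nil mulr1.
rewrite mulrBr coefB coefMX coefMC !coefB !coefX !coefC /=.
by lra.
Qed.

(** * The polynomial identity for the join *)

Section Main.
Variables (R : rcfType) (alpha : R) (G : sgraph) (t a b : nat).
Hypothesis alpha01 : 0 <= alpha <= 1.
Hypothesis G_regular : regular G t.
Hypothesis G_nonempty : (0 < #|G|)%N.
Hypotheses (a_gt0 : (0 < a)%N) (b_gt0 : (0 < b)%N).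
Let m := #|edges G|.
Let P : {poly R} := 'X - (alpha * (2 * t%:R + (a + b)%:R + 2) - 2)%:P.

Lemma char_poly_Qjoin :
  P ^+ #|G| * char_poly (Aalpha (Qedge_join G (Kab a b)) alpha) =
  P ^+ m * ('X - (alpha * (m%:R + a%:R))%:P) ^+ (b - 1)
  * ('X - (alpha * (m%:R + b%:R))%:P) ^+ (a - 1)
  * (\prod_(i <- index_iota 2 #|G|.+1)
        Qjoin_quadratic alpha t a b (lambda (Aalpha G alpha) i)
     * Qjoin_quartic alpha t m a b).
Proof.
pose Q : {poly R} := 'X - (alpha * t%:R)%:P.
pose Qb : {poly R} := 'X - (alpha * t%:R - (1 - alpha))%:P.
pose ZL : {poly R} := 'X - (alpha * (m%:R + b%:R))%:P.
pose ZR : {poly R} := 'X - (alpha * (m%:R + a%:R))%:P.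
pose Den : {poly R} := 'X^2 - (2 * alpha * m%:R + alpha * (a + b)%:R) *: 'X
     + (alpha ^+ 2 * m%:R ^+ 2 + alpha ^+ 2 * m%:R * (a + b)%:R
        + 2 * alpha * a%:R * b%:R - a%:R * b%:R)%:P.
(* The divisor collects the seven quantities that [generic_char_poly] requires to be nonzero. *)
apply: (@eq_poly_generic _ _ _ (Q * Qb * P * ZL * ZR * Den * Qjoin_quadratic alpha t a b t%:R)).
  by rewrite !mulf_neq0 ?polyXsubC_eq0 ?quadratic_neq0.
move=> nu; rewrite !hornerM !mulf_eq0 !negb_or -!andbA.
have QE : Q.[nu] = nu - alpha * t%:R by rewrite hornerXsubC.
have QbE : Qb.[nu] = nu - alpha * t%:R + (1 - alpha) by rewrite hornerXsubC; ring.
have PE : P.[nu] = nu - alpha * (2 * t%:R + (a + b)%:R + 2) + 2 by rewrite hornerXsubC; ring.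
have ZLE : ZL.[nu] = nu - alpha * (#|edge G|%:R + b%:R) by rewrite hornerXsubC card_edgeE.
have ZRE : ZR.[nu] = nu - alpha * (#|edge G|%:R + a%:R) by rewrite hornerXsubC card_edgeE.
have DenE : Den.[nu] = ZL.[nu] * ZR.[nu] - (1 - alpha) ^+ 2 * a%:R * b%:R.
  by rewrite ?hornerXsubC !(hornerD, hornerN, hornerZ, hornerXn, hornerX, hornerC) natrD; ring.
have quadE x : (Qjoin_quadratic alpha t a b x).[nu] =
  P.[nu] * Q.[nu] - Qb.[nu] * ((1 - 2 * alpha) * t%:R + x).
  by rewrite ?hornerXsubC !(hornerD, hornerN, hornerZ, hornerXn, hornerX, hornerC) natrD; ring.
rewrite quadE DenE => /and5P[].
rewrite QE QbE PE ZLE ZRE => Q0 Qb0 P0 ZL0 /and3P[ZR0 Den0 quad0].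
have charG : char_poly (Aalpha G alpha) = \prod_(x <- t%:R ::
    [seq lambda (Aalpha G alpha) i | i <- index_iota 2 #|G|.+1]) ('X - x%:P).
  by rewrite -(spectrum_regular alpha01 G_regular G_nonempty) -char_poly_sym ?Aalpha_sym.
have := generic_char_poly G_regular a_gt0 b_gt0 Q0 P0 ZL0 ZR0 Den0 Qb0 quad0 charG.
rewrite !horner_exp -/P -/ZR -/ZL PE ZRE ZLE => ->.
rewrite card_edgeE -/m big_map horner_prod.
under [X in _ = _ * (X * _)]eq_bigr do rewrite quadE PE QE QbE.
move: (\prod_(2 <= j < _) _) => pr.
(* The two quadratics inside the quartic are [quad t] and the denominator of the coronal. The last
   factor is its numerator, rewritten with [a^2 + b^2 = (a + b)^2 - 2 a b]. *)
have -> : (Qjoin_quartic alpha t m a b).[nu] =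
    (P.[nu] * Q.[nu] - Qb.[nu] * ((1 - 2 * alpha) * t%:R + t%:R))
      * (ZL.[nu] * ZR.[nu] - (1 - alpha) ^+ 2 * a%:R * b%:R)
    - m%:R * (1 - alpha) ^+ 2 * Q.[nu]
      * (a%:R * (ZR.[nu] + (1 - alpha) * b%:R) + b%:R * (ZL.[nu] + (1 - alpha) * a%:R)).
  rewrite /Qjoin_quartic !hornerXsubC.
  rewrite !(hornerM, hornerD, hornerN, hornerZ, hornerXn, hornerX, hornerC) natrD.
  by ring.
rewrite QE QbE PE ZLE ZRE card_edgeE -/m.
set QV := _ - m%:R * _ * _ * _.
move: (_ ^+ m) (_ ^+ (a - 1)) (_ ^+ (b - 1)) QV => u v w x; ring.
Qed.

End Main.

(** * From factorizations to multisets of eigenvalues *)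

Lemma perm_realroots_mul_cat (R : rcfType) (p q : {poly R}) s1 s2 :
    p != 0 -> q != 0 -> perm_eq (realroots p) s1 -> perm_eq (realroots q) s2 ->
  perm_eq (realroots (p * q)) (s1 ++ s2).
Proof.
move=> p0 q0 ps1 qs2; apply: perm_trans (perm_realrootsM p0 q0) _.
exact: perm_cat.
Qed.

(** Makes the multiplicity [m1 - n1] a genuine difference. *)
Lemma regular_leq_edges (G : sgraph) t : regular G t -> (2 <= t)%N ->
  (#|G| <= #|edges G|)%N.
Proof.
move=> /regular_handshake; rewrite card_edgeE => H t2.
by rewrite -(leq_pmul2l (isT : 0 < 2)%N) H mulnC leq_mul2l t2 orbT.
Qed.

(** A vertex and its only neighbour form a set closed under adjacency, hence the whole graph. *)
Lemma connected_1regular_card (G : sgraph) : connected G -> regular G 1 ->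
  (0 < #|G|)%N -> #|G| = 2%N.
Proof.
move=> conn reg /card_gt0P[x _].
have /cards1P[y xyE] : #|[set y | adj x y]| == 1%N by rewrite -[#|_|]/(degree x) reg.
have xy : adj x y by have /setP/(_ y) := xyE; rewrite !inE eqxx.
have /cards1P[x' yxE] : #|[set z | adj y z]| == 1%N by rewrite -[#|_|]/(degree y) reg.
have x'x : x' = x by have /setP/(_ x) := yxE; rewrite !inE adj_sym xy => /esym/eqP.
have cl : closed (@adj G) (mem [set x; y]).
  apply: intro_closed; first by apply: sym_connect_sym; exact: adj_sym.
  move=> u v uv /set2P[] uE; move: uv; rewrite uE => uv.
    have /setP/(_ v) := xyE; rewrite !inE uv => /esym/eqP->.
    by rewrite eqxx orbT.
  have /setP/(_ v) := yxE; rewrite !inE uv x'x => /esym/eqP->.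
  by rewrite eqxx.
have <- : #|[set x; y]| = 2%N by rewrite cards2 adj_neq.
apply/esym/eq_card => z; rewrite -(closed_connect cl (conn x z)) !inE eqxx.
by [].
Qed.

(** The quartic divides a characteristic polynomial that splits over [R], so all its roots are
    real. *)
Lemma Qjoin_spectrum_split (R : rcfType) (alpha : R) (G : sgraph) (a b t m : nat) (q : {poly R}) :
    q != 0 ->
    char_poly (Aalpha (Qedge_join G (Kab a b)) alpha) =
      q * Qjoin_quartic alpha t m a b ->
  size (realroots (Qjoin_quartic alpha t m a b)) = 4%N /\
  forall s, perm_eq (realroots q) s ->
    perm_eq (spectrum (Aalpha (Qedge_join G (Kab a b)) alpha))
            (s ++ realroots (Qjoin_quartic alpha t m a b)).
Proof.
move=> q0 E; split=> [|s qs].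
  rewrite (@size_realroots_dvd _ _ (spectrum (Aalpha (Qedge_join G (Kab a b)) alpha))).
    by rewrite size_Qjoin_quartic.
  by rewrite -char_poly_sym ?Aalpha_sym // E dvdp_mull.
rewrite /spectrum E perm_realroots_mul_cat //.
by rewrite -size_poly_eq0 size_Qjoin_quartic.
Qed.

Theorem corollary4p2 (R : rcfType) (alpha : R) (G1 : sgraph) (t1 a b : nat)
    (alpha01 : 0 <= alpha <= 1)
    (G1_nonempty : (0 < #|G1|)%N) (G1_regular : regular G1 t1)
    (a_gt0 : (0 < a)%N) (b_gt0 : (0 < b)%N) :
  let n1 := #|G1| in
  let m1 := #|edges G1| in
  let n2 := (a + b)%N in
  let sp := spectrum (Aalpha (Qedge_join G1 (Kab a b)) alpha) in
  (t1 = 1%N -> connected G1 ->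
   let quartic : {poly R} :=
     ('X^2 - (alpha * (3 + n2%:R)) *: 'X
        + (alpha ^+ 2 * n2%:R + 4 * alpha - 2)%:P)
     * ('X^2 - (alpha * (2 + n2%:R)) *: 'X
        + (alpha ^+ 2 + alpha ^+ 2 * n2%:R + 2 * alpha * a%:R * b%:R
           - a%:R * b%:R)%:P)
     - ((1 - alpha) ^+ 2)%:P * ('X - alpha%:P)
       * (('X - alpha%:P) * n2%:R%:P
          - (alpha * n2%:R ^+ 2)%:P + (2 * a%:R * b%:R)%:P) in
   size (realroots quartic) = 4%N /\
   perm_eq sp
     ([:: alpha]
      ++ nseq (b - 1) (alpha * (1 + a%:R))
      ++ nseq (a - 1) (alpha * (1 + b%:R))
      ++ realroots quartic))
  /\
  ((2 <= t1)%N ->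
   let quadratic (i : nat) : {poly R} :=
     let li := lambda (Aalpha G1 alpha) i in
     'X^2 - (alpha * (t1%:R + n2%:R + 2) + t1%:R - 2 + li) *: 'X
       + (alpha ^+ 2 * t1%:R * n2%:R
          + (alpha * (t1%:R + 1) - 1) * (t1%:R + li))%:P in
   let quartic : {poly R} :=
     ('X^2 - (alpha * t1%:R + alpha * n2%:R + 2 * t1%:R - 2 + 2 * alpha) *: 'X
        + (alpha ^+ 2 * t1%:R * n2%:R + 2 * alpha * t1%:R ^+ 2
           + 2 * alpha * t1%:R - 2 * t1%:R)%:P)
     * ('X^2 - (2 * alpha * m1%:R + alpha * n2%:R) *: 'X
        + (alpha ^+ 2 * m1%:R ^+ 2 + alpha ^+ 2 * m1%:R * n2%:R
           + 2 * alpha * a%:R * b%:R - a%:R * b%:R)%:P)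
     - (m1%:R * (1 - alpha) ^+ 2)%:P * ('X - (alpha * t1%:R)%:P)
       * (('X - (alpha * m1%:R)%:P) * n2%:R%:P
          - (alpha * n2%:R ^+ 2)%:P + (2 * a%:R * b%:R)%:P) in
   size (realroots quartic) = 4%N /\
   perm_eq sp
     (nseq (m1 - n1) (alpha * (2 * t1%:R + n2%:R + 2) - 2)
      ++ nseq (b - 1) (alpha * (m1%:R + a%:R))
      ++ nseq (a - 1) (alpha * (m1%:R + b%:R))
      ++ flatten [seq realroots (quadratic i) | i <- index_iota 2 n1.+1]
      ++ realroots quartic)).
Proof.
move=> n1 m1 n2 sp.
have P0 k : ('X - (alpha * (2 * t1%:R + (a + b)%:R + 2) - 2)%:P) ^+ k != 0 :> {poly R}.
  by rewrite expf_neq0 ?polyXsubC_eq0.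
have X0 (c : R) k : ('X - c%:P) ^+ k != 0 by rewrite expf_neq0 ?polyXsubC_eq0.
have charM := char_poly_Qjoin alpha01 G1_regular G1_nonempty a_gt0 b_gt0.
split=> [t1E conn quartic | t1_ge2 quadratic quartic].
  (* Connectedness leaves only K_2, so [n1 = 2] and [m1 = 1]. *)
  subst t1; have card2 := connected_1regular_card conn G1_regular G1_nonempty.
  have m1E : m1 = 1%N.
    by have := regular_handshake G1_regular; rewrite card_edgeE -/m1 card2; lia.
  have -> : quartic = Qjoin_quartic alpha 1 1 a b.
    rewrite /quartic /Qjoin_quartic !(mul1r, expr1n, mulr1).
    by congr (('X^2 - _ *: 'X + _%:P) * ('X^2 - _ *: 'X + _%:P) - _); rewrite /n2; ring.
  move: charM; rewrite -/m1 m1E {1}card2 /index_iota {1}card2 /= big_seq1.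
  rewrite (lambda2_regular1 alpha01 G1_regular card2).
  set P := 'X - _%:P => charM.
  (* The only quadratic, at [lambda] equal to [2 * alpha - 1], contains the factor [P]. Together
     with [P ^+ m1] it cancels [P ^+ n1], and the simple eigenvalue [alpha] remains. *)
  have quadE : Qjoin_quadratic alpha 1 a b (2 * alpha - 1) = P * ('X - alpha%:P).
    apply: (@eq_poly_generic _ _ _ 1) => [|x _]; first exact: oner_neq0.
    rewrite /Qjoin_quadratic hornerM !hornerXsubC.
    by rewrite !(hornerD, hornerN, hornerZ, hornerXn, hornerX, hornerC); ring.
  have [||sz perm_sp] := @Qjoin_spectrum_split _ alpha G1 a b 1 1
    (('X - alpha%:P) ^+ 1 * (('X - (alpha * (1 + a%:R))%:P) ^+ (b - 1)
      * ('X - (alpha * (1 + b%:R))%:P) ^+ (a - 1))).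
  - by rewrite !mulf_neq0.
  - by apply: (mulfI (P0 2)); rewrite charM quadE -/P; ring.
  split=> //; rewrite catA.
  apply: (perm_sp (nseq 1 alpha ++ (nseq _ _ ++ nseq _ _))).
  by rewrite !perm_realroots_mul_cat ?mulf_neq0 ?perm_realroots_XsubCX.
have -> : quartic = Qjoin_quartic alpha t1 m1 a b by [].
have mn := regular_leq_edges G1_regular t1_ge2.
set P := 'X - (alpha * (2 * t1%:R + n2%:R + 2) - 2)%:P : {poly R}.
have quad0 i : quadratic i != 0 by exact: quadratic_neq0.
have prod0 : \prod_(i <- index_iota 2 n1.+1) quadratic i != 0.
  by elim/big_ind: _ => [|u v|i _]; [exact: oner_neq0 | exact: mulf_neq0 | exact: quad0].
have [||sz perm_sp] := @Qjoin_spectrum_split _ alpha G1 a b t1 m1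
    (P ^+ (m1 - n1) * (('X - (alpha * (m1%:R + a%:R))%:P) ^+ (b - 1)
      * (('X - (alpha * (m1%:R + b%:R))%:P) ^+ (a - 1)
         * \prod_(i <- index_iota 2 n1.+1) quadratic i))).
- by rewrite !mulf_neq0.
- apply: (mulfI (P0 n1)); rewrite charM -/P -/m1.
  (* Cancelling [P ^+ n1] leaves the multiplicity of item (b)(i). *)
  have -> : P ^+ m1 = P ^+ n1 * P ^+ (m1 - n1) by rewrite -exprD subnKC.
  by rewrite -!mulrA.
split=> //; rewrite !catA; apply: perm_sp; rewrite -!catA.
by rewrite !perm_realroots_mul_cat ?mulf_neq0 ?perm_realroots_XsubCX ?perm_realroots_prod //.
Qed.
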